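(* Let $n$ be a positive integer. Then $\sigma_{[1,2,\ldots,n]}$ is the least group congruence on $\mathscr{IO}_{\infty}(\mathbb{Z}^n_{\mathrm{lex}})$, i.e., $\sigma_{[1,2,\ldots,n]}=\sigma$.
   Context: $L_n=\{1,\ldots,n\}$ with its usual order; $L_n\times_{\mathrm{lex}}\mathbb{Z}$ is $L_n\times\mathbb{Z}$ with the lexicographic order: $(i,m)\leqslant(j,l)$ iff $i<j$, or $i=j$ and $m\le l$. $\mathscr{IO}_{\infty}(\mathbb{Z}^n_{\mathrm{lex}})$ is the inverse monoid of all injective partial maps $\alpha$ from $L_n\times\mathbb{Z}$ to itself that are monotone ($x\leqslant y$ in $\operatorname{dom}\alpha$ implies $(x)\alpha\leqslant(y)\alpha$) and such that both $\operatorname{dom}\alpha$ and $\operatorname{ran}\alpha$ have finite complement in $L_n\times\mathbb{Z}$; the operation is composition of partial maps written on the right, $(x)(\alpha\beta)=((x)\alpha)\beta$. $\mathscr{IO}_{\infty}(\mathbb{Z})$ is the analogous monoid of injective monotone partial selfmaps of $\mathbb{Z}$ (usual order) with cofinite domain and image. Every element of $\mathscr{IO}_{\infty}(\mathbb{Z}^n_{\mathrm{lex}})$ preserves the first coordinate, so $\mathscr{IO}_{\infty}(\mathbb{Z}^n_{\mathrm{lex}})$ is identified with the direct power $(\mathscr{IO}_{\infty}(\mathbb{Z}))^n$ by $\alpha\leftrightarrow(\alpha_1,\ldots,\alpha_n)$, where $(i,k)\alpha=(i,(k)\alpha_i)$. For $\varepsilon\in\mathscr{IO}_{\infty}(\mathbb{Z})$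 let $\varepsilon_i^\circ$ denote the element whose $i$-th coordinate is $\varepsilon$ and whose other coordinates are the identity. The congruence $\sigma_{[i]}$ is defined by: $\alpha\,\sigma_{[i]}\,\beta$ iff there exists an idempotent $\varepsilon\in\mathscr{IO}_{\infty}(\mathbb{Z})$ such that $\alpha\varepsilon_i^\circ=\beta\varepsilon_i^\circ$. Further, $\sigma_{[1,\ldots,n]}=\sigma_{[1]}\circ\cdots\circ\sigma_{[n]}$ (composition of binary relations). A group congruence is a congruence whose quotient is a group; on an inverse semigroup $S$ the least group congruence $\sigma$ is given by $a\,\sigma\,b$ iff $ae=be$ for some idempotent $e\in S$. *)

(* Defs.v *)
From HB Require Import structures.
From mathcomp Require Import all_boot all_order all_algebra.
From mathcomp Require Import generic_quotient.
From mathcomp Require Import boolp classical_sets cardinality.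

Set Implicit Arguments.
Unset Strict Implicit.
Unset Printing Implicit Defensive.

Import Order.TTheory.
Local Open Scope classical_set_scope.
Local Open Scope quotient_scope.
Local Open Scope group_scope.

Definition is_idempotent (S : semigroupType) (e : S) : Prop := e * e = e.

Definition is_group (S : semigroupType) : Prop :=
  exists e : S, (forall x : S, e * x = x /\ x * e = x) /\
    (forall x : S, exists y : S, y * x = e /\ x * y = e).

Record is_congruence (S : semigroupType) (rho : S -> S -> Prop) : Prop :=
  IsCongruence {
    congr_refl : forall a, rho a a;
    congr_sym : forall a b, rho a b -> rho b a;
    congr_trans : forall a b c, rho a b -> rho b c -> rho a c;
    congr_mul : forall a b c d, rho a b -> rho c d -> rho (a * c) (b * d)
  }.

Section QuotientSemigroup.
Variables (S : semigroupType) (rho : S -> S -> Prop) (c : is_congruence rho).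

Let congr_bool : rel S := fun a b => `[< rho a b >].

Fact congr_bool_refl : reflexive congr_bool.
Proof. by move=> a; apply/asboolP; exact: (congr_refl c). Qed.

Fact congr_bool_sym : symmetric congr_bool.
Proof. by move=> a b; apply/asboolP/asboolP; exact: (congr_sym c). Qed.

Fact congr_bool_trans : transitive congr_bool.
Proof. by move=> b a d /asboolP h /asboolP k; apply/asboolP/(congr_trans c h k). Qed.

Definition congr_equiv :=
  EquivRel congr_bool congr_bool_refl congr_bool_sym congr_bool_trans.

Definition quotient : Type := {eq_quot congr_equiv}.

HB.instance Definition _ := Choice.on quotient.

Definition quotient_class (a : S) : quotient := \pi_({eq_quot congr_equiv}) a.

Definition quotient_repr (x : quotient) : S :=
  repr (x : {eq_quot congr_equiv}).

Definition quotient_mul (x y : quotient) : quotient :=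
  quotient_class (quotient_repr x * quotient_repr y).

Fact quotient_classP a b : quotient_class a = quotient_class b <-> rho a b.
Proof.
rewrite /quotient_class; split=> [/eqP|h].
  by rewrite piE => /asboolP.
by apply/eqP; rewrite piE; apply/asboolP.
Qed.

Fact quotient_reprK x : quotient_class (quotient_repr x) = x.
Proof. exact: reprK. Qed.

Fact quotient_mulE a b :
  quotient_mul (quotient_class a) (quotient_class b) = quotient_class (a * b).
Proof.
by apply/quotient_classP/(congr_mul c); apply/quotient_classP/quotient_reprK.
Qed.

Fact quotient_mulA : associative quotient_mul.
Proof.
move=> x y z.
rewrite -(quotient_reprK x) -(quotient_reprK y) -(quotient_reprK z).
by rewrite !quotient_mulE mulgA.
Qed.

HB.instance Definition _ := isSemigroup.Build quotient quotient_mulA.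

End QuotientSemigroup.

Definition is_group_congruence (S : semigroupType) (rho : S -> S -> Prop) :=
  exists c : is_congruence rho, is_group (quotient c).

Definition is_least_group_congruence (S : semigroupType)
    (rho : S -> S -> Prop) : Prop :=
  is_group_congruence rho /\
  forall tau : S -> S -> Prop, is_group_congruence tau ->
    forall a b, rho a b -> tau a b.

(* This describes the least group congruence when S is an inverse semigroup. *)
Definition sigma (S : semigroupType) (a b : S) : Prop :=
  exists e : S, is_idempotent e /\ a * e = b * e.

Definition rel_comp (S : Type) (rho tau : S -> S -> Prop) (a b : S) : Prop :=
  exists c, rho a c /\ tau c b.

(* Partial selfmaps of T are functions T -> option T, undefined where None. *)
Section PartialMaps.
Variables (d : Order.disp_t) (T : porderType d).

Definition pdom (f : T -> option T) : set T := [set x | exists y, f x = Some y].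
Definition pran (f : T -> option T) : set T := [set y | exists x, f x = Some y].

Record IOinf := IOInf {
  IOfun :> T -> option T;
  IOfun_inj : forall x y z, IOfun x = Some z -> IOfun y = Some z -> x = y;
  IOfun_mono : forall x y x' y', IOfun x = Some x' -> IOfun y = Some y' ->
    (x <= y)%O -> (x' <= y')%O;
  IOfun_dom : cofinite_set (pdom IOfun);
  IOfun_ran : cofinite_set (pran IOfun)
}.

HB.instance Definition _ := gen_eqMixin IOinf.
HB.instance Definition _ := gen_choiceMixin IOinf.

Fact IOinf_eq (f g : IOinf) : f =1 g -> f = g.
Proof.
case: f g => [f f1 f2 f3 f4] [g g1 g2 g3 g4] /= /funext fg.
by case: _ / fg in g1 g2 g3 g4 *; congr IOInf.
Qed.

Fact IOone_inj :
  forall x y z, @Some T x = Some z -> @Some T y = Some z -> x = y.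
Proof. by move=> x y z [->] [->]. Qed.

Fact IOone_mono :
  forall x y x' y',
  @Some T x = Some x' -> @Some T y = Some y' -> (x <= y)%O -> (x' <= y')%O.
Proof. by move=> x y x' y' [->] [->]. Qed.

Fact IOone_dom : cofinite_set (pdom (@Some T)).
Proof.
by apply: sub_finite_set (finite_set0 T) => x; apply; exists x.
Qed.

Fact IOone_ran : cofinite_set (pran (@Some T)).
Proof.
by apply: sub_finite_set (finite_set0 T) => x; apply; exists x.
Qed.

Definition IOone : IOinf :=
  IOInf IOone_inj IOone_mono IOone_dom IOone_ran.

Fact IOmul_inj (f g : IOinf) :
  forall x y z, pcomp g f x = Some z -> pcomp g f y = Some z -> x = y.
Proof.
move=> x y z; rewrite /pcomp.
case fx: (f x) => [a|] //= ga; case fy: (f y) => [b|] //= gb.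
by have ab := IOfun_inj ga gb; rewrite -ab in fy; exact: IOfun_inj fx fy.
Qed.

Fact IOmul_mono (f g : IOinf) :
  forall x y x' y',
  pcomp g f x = Some x' -> pcomp g f y = Some y' -> (x <= y)%O -> (x' <= y')%O.
Proof.
move=> x y x' y'; rewrite /pcomp.
case fx: (f x) => [a|] //= ga; case fy: (f y) => [b|] //= gb xy.
exact: IOfun_mono ga gb (IOfun_mono fx fy xy).
Qed.

Fact IOmul_dom (f g : IOinf) : cofinite_set (pdom (pcomp g f)).
Proof.
pose A : set T := [set x | exists2 y, f x = Some y & ~ pdom g y].
have finA : finite_set A.
  pose finv y := if pselect (pran f y) is left h then projT1 (cid h) else y.
  have := finite_image finv (IOfun_dom g).
  apply: sub_finite_set => x [y fxy gy] /=; exists y => //; rewrite /finv.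
  by case: pselect => [h|[]]; [case: cid => z /= fz; exact: IOfun_inj fz fxy|exists x].
have : finite_set (~` pdom f `|` A) by rewrite finite_setU; split=> //; exact: IOfun_dom.
apply: sub_finite_set => x; rewrite /pdom /pcomp /= => nx.
case fx: (f x) => [y|]; last by left=> -[y fy]; rewrite fy in fx.
right; exists y => // -[z gy]; apply: nx; exists z; by rewrite fx.
Qed.

Fact IOmul_ran (f g : IOinf) : cofinite_set (pran (pcomp g f)).
Proof.
pose A : set T := [set z | exists2 y, g y = Some z & ~ pran f y].
have finA : finite_set A.
  have := finite_image (fun y => odflt y (g y)) (IOfun_ran f).
  by apply: sub_finite_set => z [y gy fy] /=; exists y => //; rewrite gy.
have : finite_set (~` pran g `|` A) by rewrite finite_setU; split=> //; exact: IOfun_ran.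
apply: sub_finite_set => z; rewrite /pran /pcomp /= => nz.
have [[y gy]|] := pselect (pran g z); last by left.
right; exists y => // -[x fx]; apply: nz; exists x; by rewrite fx.
Qed.

(* maps act on the right: x (f g) = (x f) g *)
Definition IOmul (f g : IOinf) : IOinf :=
  IOInf (@IOmul_inj f g) (@IOmul_mono f g) (@IOmul_dom f g) (@IOmul_ran f g).

Fact IOmulA : associative IOmul.
Proof. by move=> f g h; apply: IOinf_eq => x; rewrite /= /pcomp; case: (f x). Qed.

Fact IOmul1 : left_id IOone IOmul.
Proof. by move=> f; apply: IOinf_eq. Qed.

Fact IOmulr1 : right_id IOone IOmul.
Proof. by move=> f; apply: IOinf_eq => x; rewrite /= /pcomp; case: (f x). Qed.

HB.instance Definition _ := isMonoid.Build IOinf IOmulA IOmul1 IOmulr1.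

End PartialMaps.

(* L_n is 'I_n, so its elements are numbered from 0. *)
Notation IOZ := (IOinf int).
Notation IOZlex n := (IOinf ('I_n *l int)%type).

Section Lex.
Variable n : nat.

(* (i, k) |-> (i, k alpha_i), the identification of the direct power of IOZ
   with IOZlex n *)
Definition tuple_fun (alpha : 'I_n -> IOZ) (x : 'I_n *l int) :
    option ('I_n *l int) :=
  omap (fun k : int => (x.1, k) : 'I_n *l int) (alpha x.1 x.2).

Fact tuple_funP alpha (x y : 'I_n *l int) :
  tuple_fun alpha x = Some y <-> x.1 = y.1 /\ alpha x.1 x.2 = Some y.2.
Proof.
case: x y => [i k] [j l]; rewrite /tuple_fun /=.
by case: (alpha i k) => [m|] /=; split=> [[]|[]] // -> => [->|[->]].
Qed.

Fact of_tuple_inj (alpha : 'I_n -> IOZ) :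
  forall x y z, tuple_fun alpha x = Some z -> tuple_fun alpha y = Some z -> x = y.
Proof.
move=> [i k] [j l] [m p] /tuple_funP/= [-> h] /tuple_funP/= [-> h'].
by rewrite (IOfun_inj h h').
Qed.

Fact of_tuple_mono (alpha : 'I_n -> IOZ) :
  forall x y x' y',
  tuple_fun alpha x = Some x' -> tuple_fun alpha y = Some y' ->
    (x <= y)%O -> (x' <= y')%O.
Proof.
move=> [i k] [j l] [i' k'] [j' l'] /tuple_funP/= [<- h] /tuple_funP/= [<- h'].
rewrite !lexi_pair => /andP[ij /implyP kl]; rewrite ij /=; apply/implyP => ji.
have e : i = j by apply/le_anti; rewrite ij ji.
by subst j; exact: IOfun_mono h h' (kl ji).
Qed.

Fact of_tuple_dom (alpha : 'I_n -> IOZ) : cofinite_set (pdom (tuple_fun alpha)).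
Proof.
have := @bigcup_finite _ _ setT
  (fun i : 'I_n => (fun k => (i, k) : 'I_n *l int) @` (~` pdom (alpha i)))%classic
  (@finite_finset _ _) (fun i _ => finite_image _ (IOfun_dom (alpha i))).
apply: sub_finite_set => -[i k] h; exists i => //; exists k => // -[l kl].
by apply: h; exists (i, l); apply/tuple_funP.
Qed.

Fact of_tuple_ran (alpha : 'I_n -> IOZ) : cofinite_set (pran (tuple_fun alpha)).
Proof.
have := @bigcup_finite _ _ setT
  (fun i : 'I_n => (fun k => (i, k) : 'I_n *l int) @` (~` pran (alpha i)))%classic
  (@finite_finset _ _) (fun i _ => finite_image _ (IOfun_ran (alpha i))).
apply: sub_finite_set => -[i k] h; exists i => //; exists k => // -[l kl].
by apply: h; exists (i, l); apply/tuple_funP.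
Qed.

Definition of_tuple (alpha : 'I_n -> IOZ) : IOZlex n :=
  IOInf (@of_tuple_inj alpha) (@of_tuple_mono alpha)
    (@of_tuple_dom alpha) (@of_tuple_ran alpha).

Definition coord (i : 'I_n) (eps : IOZ) : IOZlex n :=
  of_tuple (fun j => if j == i then eps else 1).

Definition sigma_coord (i : 'I_n) (alpha beta : IOZlex n) : Prop :=
  exists eps : IOZ, is_idempotent eps /\
    alpha * coord i eps = beta * coord i eps.

(* composition over 'I_n in increasing order; the trailing factor = of the
   iterated operator is neutral *)
Definition sigma_all : IOZlex n -> IOZlex n -> Prop :=
  \big[@rel_comp (IOZlex n) / eq]_(i < n) sigma_coord i.

End Lex.

(* Main.v *)
(* Two elements are sigma-related iff they differ at finitely many points only:
   if [a e = b e] they agree wherever [a e] is defined, and conversely one can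
   take for [e] the identity off the finitely many values taken where they
   differ. In this form sigma is visibly a congruence, and the inverse partial
   maps make the quotient a group. Since every element preserves the first
   coordinate, it is a tuple of components; replacing the components of [a] by
   those of [b] one after the other links [a] to [b] through the
   [sigma_coord i]. *)
Require Import Defs.
From mathcomp Require Import all_boot all_order all_algebra.
From mathcomp Require Import boolp classical_sets cardinality.
From mathcomp Require Import zify.

Set Implicit Arguments.
Unset Strict Implicit.
Unset Printing Implicit Defensive.

Import Order.TTheory GRing.Theory Num.Theory.
Local Open Scope classical_set_scope.
Local Open Scope group_scope.

(** * Group congruences and quotients *)

Lemma finite_set_avoid (T : Type) (A : set T) (f : nat -> T) :
  injective f -> finite_set A -> exists m, ~ A (f m).
Proof.
move=> f_inj finA; apply/existsNP => Af; apply: infinite_nat.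
apply: sub_finite_set (finite_preimage (in2W f_inj) finA) => m _; exact: Af.
Qed.

Lemma is_group_idempotent (S : semigroupType) (e x : S) :
  is_group S -> is_idempotent e ->
  x * e = x.
Proof.
move=> [u [u1 uV]] ee; have [y [ye _]] := uV e.
have -> : e = u by rewrite -(u1 e).1 -ye -mulgA ee.
exact: (u1 x).2.
Qed.

(** The class of [e] is an idempotent of the group [quotient c], hence its identity, so
    [a * e = b * e] identifies the classes of [a] and [b]. *)
Lemma sigma_sub_group_congruence (S : semigroupType) (tau : S -> S -> Prop)
    (a b : S) :
  is_group_congruence tau -> sigma a b -> tau a b.
Proof.
move=> [c grp] [e [ee abe]]; apply/(quotient_classP c).
have idem : @is_idempotent (quotient c) (quotient_class c e).
  by rewrite /is_idempotent [LHS]quotient_mulE ee.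
rewrite -(is_group_idempotent (quotient_class c a) grp idem).
rewrite -(is_group_idempotent (quotient_class c b) grp idem).
rewrite [LHS](quotient_mulE c) [RHS](quotient_mulE c); exact: congr1.
Qed.

Lemma is_group_quotient (M : monoidType) (rho : M -> M -> Prop)
    (c : is_congruence rho) :
  (forall a, exists b, rho (b * a) 1 /\ rho (a * b) 1) -> is_group (quotient c).
Proof.
move=> rhoV; exists (quotient_class c 1); split=> x.
  rewrite -(quotient_reprK x); split.
  - by rewrite [LHS]quotient_mulE mul1g.
  - by rewrite [LHS]quotient_mulE mulg1.
rewrite -(quotient_reprK x); have [b [ba ab]] := rhoV (quotient_repr x).
exists (quotient_class c b).
by split; rewrite [LHS]quotient_mulE; exact/quotient_classP.
Qed.

Lemma pcomp_Some (A B C : Type) (g : B -> option C) (f : A -> option B) x z :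
  pcomp g f x = Some z <-> exists2 y, f x = Some y & g y = Some z.
Proof.
rewrite /pcomp; case: (f x) => [y|] /=; last by split=> // -[].
by split=> [gy|[y' [->]]//]; exists y.
Qed.

(** * Partial maps that differ at finitely many points *)

Section AlmostEqual.
Variables (d : Order.disp_t) (T : porderType d).
Implicit Types a b c e f : IOinf T.

Lemma idempotentE e x y : is_idempotent e -> e x = Some y -> x = y.
Proof.
move=> ee ex; have := ex; rewrite -{1}ee /= => /pcomp_Some[z].
rewrite ex => -[<-] ey; exact: IOfun_inj ex ey.
Qed.

Definition pid_fun (A : set T) (x : T) : option T :=
  if `[< A x >] then Some x else None.

Lemma pid_funP A x y : pid_fun A x = Some y <-> A x /\ x = y.
Proof.
rewrite /pid_fun; case: asboolP => Ax; first by split=> [[<-]|[_ ->]].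
by split=> // -[].
Qed.

Section PartialIdentity.
Variables (A : set T) (finA : finite_set A).

Fact pid_inj x y z :
  pid_fun (~` A) x = Some z -> pid_fun (~` A) y = Some z -> x = y.
Proof. by move=> /pid_funP[_ ->] /pid_funP[_ ->]. Qed.

Fact pid_mono x y x' y' :
  pid_fun (~` A) x = Some x' -> pid_fun (~` A) y = Some y' ->
  (x <= y)%O -> (x' <= y')%O.
Proof. by move=> /pid_funP[_ ->] /pid_funP[_ ->]. Qed.

Fact pid_dom : cofinite_set (pdom (pid_fun (~` A))).
Proof.
apply: sub_finite_set finA => x nx; apply: contrapT => Ax; apply: nx.
by exists x; apply/pid_funP.
Qed.

Fact pid_ran : cofinite_set (pran (pid_fun (~` A))).
Proof.
apply: sub_finite_set finA => x nx; apply: contrapT => Ax; apply: nx.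
by exists x; apply/pid_funP.
Qed.

Definition pid : IOinf T := IOInf pid_inj pid_mono pid_dom pid_ran.

Lemma pid_idempotent : is_idempotent pid.
Proof.
apply: IOinf_eq => x /=; rewrite /pcomp /pid_fun.
by case: asboolP => //= Ax; case: asboolP.
Qed.

End PartialIdentity.

Definition almost_eq a b := finite_set [set x | a x <> b x].

Lemma sigmaP a b : sigma a b <-> almost_eq a b.
Proof.
split=> [[e [ee abe]]|fin_ab].
  have fin_ae := IOfun_dom (a * e).
  (* Where [a * e] is defined, so is [b * e], with the same value; injectivity of [e] then gives
     [a x = b x]. *)
  apply: sub_finite_set fin_ae => x nab [y aexy]; apply: nab.
  have := aexy; rewrite abe => /pcomp_Some[v -> ev].
  move: aexy => /pcomp_Some[u -> eu]; congr Some; exact: IOfun_inj eu ev.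
pose A := [set x | a x <> b x].
(* Where a map is undefined, the default [x] only adds a harmless point: [B] stays finite and
   contains every value taken on [A]. *)
pose B := (fun x => odflt x (a x)) @` A `|` (fun x => odflt x (b x)) @` A.
have finB : finite_set B by rewrite finite_setU; split; exact: finite_image.
exists (pid finB); split; first exact: pid_idempotent.
apply: IOinf_eq => x /=; have [abx|nabx] := pselect (a x = b x).
  by rewrite /pcomp abx.
have Ba y : a x = Some y -> B y by move=> axy; left; exists x; rewrite ?axy.
have Bb y : b x = Some y -> B y by move=> bxy; right; exists x; rewrite ?bxy.
rewrite /pcomp; transitivity (@None T).
  case ax: (a x) => [y|] //=; rewrite /pid_fun; case: asboolP => // nBy.
  by case: nBy; exact: Ba.
case bx: (b x) => [y|] //=; rewrite /pid_fun; case: asboolP => // nBy.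
by case: nBy; exact: Bb.
Qed.

Lemma almost_eq_congruence : is_congruence almost_eq.
Proof.
split.
- by move=> a; apply: sub_finite_set (finite_set0 T) => x.
- by move=> a b; apply: sub_finite_set => x ab /esym.
- move=> a b c ab bc.
  have : finite_set ([set x | a x <> b x] `|` [set x | b x <> c x]).
    by rewrite finite_setU.
  apply: sub_finite_set => x nac.
  have [abx|] := pselect (a x = b x); last by left.
  by right; rewrite /= -abx.
move=> a b c e ab ce.
(* If [a] and [b] agree at [x], the products can differ there only when the common value is a point
   where [c] and [e] differ. *)
pose A := [set x | a x = b x /\ exists2 y, a x = Some y & c y <> e y].
have finA : finite_set A.
  pose B := [set some y | y in [set y | c y <> e y]].
  (* As a map into [option T], [a] may send many points to [None]; it is injective only over defined
     values, and [B] holds no others. *)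
  have a_inj : {in (a @^-1` B)%classic &, injective a}.
    move=> x x' /set_mem[y _ ay] _ axx'.
    by apply: (@IOfun_inj _ _ a _ _ y); rewrite -?axx'.
  apply: sub_finite_set (finite_preimage a_inj (finite_image _ ce)).
  by move=> x [_ [y ax cey]]; exists y.
have : finite_set ([set x | a x <> b x] `|` A) by rewrite finite_setU.
apply: sub_finite_set => x nx.
have [abx|] := pselect (a x = b x); last by left.
right; split=> //; move: nx; rewrite /= /pcomp -abx.
by case: (a x) => [y|] //= cey; exists y.
Qed.

End AlmostEqual.

(** * Inverse partial maps, and leastness of [sigma] *)

Section Inverse.
Variables (d : Order.disp_t) (T : orderType d) (a : IOinf T).

Definition pinv_fun (y : T) : option T :=
  if pselect (pran a y) is left h then Some (projT1 (cid h)) else None.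

Lemma pinv_funP x y : pinv_fun y = Some x <-> a x = Some y.
Proof.
rewrite /pinv_fun; case: pselect => [h|nh]; last first.
  by split=> // axy; case: nh; exists x.
case: cid => z /= az; split=> [[<-]//|ax]; congr Some; exact: IOfun_inj az ax.
Qed.

Fact pinv_inj x y z : pinv_fun x = Some z -> pinv_fun y = Some z -> x = y.
Proof. by move=> /pinv_funP az /pinv_funP; rewrite az => -[]. Qed.

(** Totality of the order turns a failure into [y' < x']; monotonicity of [a] then forces [x = y],
    against injectivity. *)
Fact pinv_mono x y x' y' : pinv_fun x = Some x' -> pinv_fun y = Some y' ->
  (x <= y)%O -> (x' <= y')%O.
Proof.
move=> /pinv_funP ax /pinv_funP ay xy.
case: (leP x' y') => // lt_yx; have yx := IOfun_mono ay ax (ltW lt_yx).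
have exy : x = y by apply/le_anti; rewrite xy yx.
by rewrite exy in ax; rewrite (IOfun_inj ax ay) ltxx in lt_yx.
Qed.

Fact pinv_dom : cofinite_set (pdom pinv_fun).
Proof.
apply: sub_finite_set (IOfun_ran a) => y ny [x ax]; apply: ny.
by exists x; apply/pinv_funP.
Qed.

Fact pinv_ran : cofinite_set (pran pinv_fun).
Proof.
apply: sub_finite_set (IOfun_dom a) => y ny [x ax]; apply: ny.
by exists x; apply/pinv_funP.
Qed.

Definition pinv : IOinf T := IOInf pinv_inj pinv_mono pinv_dom pinv_ran.

Lemma mul_pinv : almost_eq (a * pinv) 1.
Proof.
apply: sub_finite_set (IOfun_dom a) => x nx [y ax]; apply: nx.
by apply/pcomp_Some; exists y => //; apply/pinv_funP.
Qed.

Lemma pinv_mul : almost_eq (pinv * a) 1.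
Proof.
apply: sub_finite_set (IOfun_ran a) => y ny [x ax]; apply: ny.
by apply/pcomp_Some; exists x => //; apply/pinv_funP.
Qed.

End Inverse.

Lemma sigmaE (d : Order.disp_t) (T : porderType d) :
  @sigma (IOinf T) = @almost_eq d T.
Proof. by apply/funext => a; apply/funext => b; apply/propext/sigmaP. Qed.

Lemma sigma_least (d : Order.disp_t) (T : orderType d) :
  is_least_group_congruence (@sigma (IOinf T)).
Proof.
split; last by move=> tau grp a b; exact: sigma_sub_group_congruence.
rewrite sigmaE; exists (almost_eq_congruence T).
by apply: is_group_quotient => a; exists (pinv a); split;
  [exact: pinv_mul | exact: mul_pinv].
Qed.

(** * Preservation of the first coordinate, and components *)

Section Lex.
Variable n : nat.
Implicit Types (a b : IOZlex n) (i j : 'I_n) (k l : int).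

Lemma pdom_above a i k :
  exists m : nat, pdom a ((i, k + m%:Z)%R : 'I_n *l int).
Proof.
have inj : injective (fun m : nat => (i, k + m%:Z)%R : 'I_n *l int).
  by move=> m m' [] /addrI [].
have [m nm] := finite_set_avoid inj (IOfun_dom a).
by exists m; apply: contrapT.
Qed.

Lemma finite_same_chain i k l :
  finite_set [set x : 'I_n *l int | ((i, k) : 'I_n *l int) <= x <= (i, l)]%O.
Proof.
have := finite_image (fun m : nat => ((i, k + m%:Z)%R : 'I_n *l int))
  (finite_II `|l - k|.+1).
apply: sub_finite_set => -[j m] /= /andP[].
rewrite !lexi_pair => /andP[ij /implyP km] /andP[ji /implyP ml].
have e : j = i by apply/le_anti; rewrite ij ji.
have {}km := km ji; have {}ml := ml ij.
by exists `|m - k|%N => /=; [lia | rewrite e; congr pair; lia].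
Qed.

(* Otherwise the images of two points of one chain would have infinitely many
   elements of the range between them, while only finitely many arguments lie
   between the points. *)
Lemma same_chain a i k l (u v : 'I_n *l int) :
  a (i, k) = Some u -> a (i, l) = Some v -> u.1 = v.1.
Proof.
wlog kl : k l u v / (k <= l)%R.
  by move=> H ak al; case: (leP k l) => [kl|/ltW lk];
    [exact: H kl ak al | exact/esym/(H _ _ _ _ lk al ak)].
move=> ak al.
have : (u <= v)%O by apply: IOfun_mono ak al _; rewrite lexi_pair lexx.
case: u v ak al => [i1 p] [i2 q] ak al; rewrite lexi_pair => /andP[i12 _] /=.
apply/eqP; apply: contraT => n12.
have lt12 : (i1 < i2)%O by rewrite lt_neqAle n12.
pose A := ~` pran a `|`
  (fun x => odflt x (a x)) @` [set x | ((i, k) : 'I_n *l int) <= x <= (i, l)]%O.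
have finA : finite_set A.
  rewrite finite_setU; split; first exact: IOfun_ran.
  exact/finite_image/finite_same_chain.
have inj : injective (fun m : nat => (i1, p + m%:Z)%R : 'I_n *l int).
  by move=> m m' [] /addrI [].
have [m nA] := finite_set_avoid inj finA; case: nA.
have [[x ax]|] := pselect (pran a ((i1, p + m%:Z)%R : 'I_n *l int)); last by left.
right; exists x; last by rewrite ax.
have xa := (pinv_funP a _ _).2 ax.
apply/andP; split.
  apply: (pinv_mono ((pinv_funP a _ _).2 ak) xa).
  by rewrite lexi_pair lexx /= lerDl.
apply: (pinv_mono xa ((pinv_funP a _ _).2 al)).
by rewrite lexi_pair i12 /= leNgt lt12.
Qed.

(** Strong induction on the chain [i] of [x]. If [x] went down to a chain [j < i], take a domain
    point of chain [j], which lies below [x]. Its image is in chain [j] or higher by induction, and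
    in chain [j] or lower by monotonicity. So two points of chain [j] have preimages in the distinct
    chains [j] and [i], which [same_chain] forbids for [pinv a]. *)
Lemma fst_le a (x y : 'I_n *l int) : a x = Some y -> (x.1 <= y.1)%N.
Proof.
case: x y => [i k] [j l] /=.
have [N] := ubnP (val i); elim: N i j k l => // N IH i j k l iN ax.
rewrite leqNgt; apply/negP => ji.
have [m [[j' l'] ay]] := pdom_above a j k.
have jj' := IH _ _ _ _ (leq_trans ji iN) ay.
have : (((j', l') : 'I_n *l int) <= (j, l))%O.
  apply: IOfun_mono ay ax _.
  by rewrite lexi_pair [(j <= i)%O]ltnW //= [(i <= j)%O]leqNgt ji.
rewrite lexi_pair => /andP[j'j _].
have ejj : j' = j by apply/le_anti; rewrite j'j; exact: jj'.
rewrite ejj in ay.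
have := same_chain ((pinv_funP a _ _).2 ay : pinv a _ = _)
  ((pinv_funP a _ _).2 ax : pinv a _ = _) => /= ij.
by rewrite ij ltnn in ji.
Qed.

(** The opposite inequality is [fst_le] for the inverse map. *)
Lemma fst_preserved a (x y : 'I_n *l int) : a x = Some y -> x.1 = y.1.
Proof.
move=> ax; apply/val_inj/eqP; rewrite eqn_leq (fst_le ax) /=.
by apply: (@fst_le (pinv a)); apply/pinv_funP.
Qed.

Section Component.
Variables (a : IOZlex n) (i : 'I_n).

Definition component_fun (k : int) : option int := omap snd (a (i, k)).

Lemma component_funP k l : component_fun k = Some l <-> a (i, k) = Some (i, l).
Proof.
rewrite /component_fun; split=> [|-> //]; case ak: (a (i, k)) => [[j m]|] //=.
by move=> [<-]; have /= -> := fst_preserved ak.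
Qed.

Fact component_inj x y z :
  component_fun x = Some z -> component_fun y = Some z -> x = y.
Proof. by move=> /component_funP ax /component_funP /(IOfun_inj ax)[]. Qed.

Fact component_mono x y x' y' :
  component_fun x = Some x' -> component_fun y = Some y' ->
  (x <= y)%O -> (x' <= y')%O.
Proof.
move=> /component_funP ax /component_funP ay xy.
by have := IOfun_mono ax ay; rewrite !lexi_pair lexx /=; exact.
Qed.

Let pair_inj (A : set int) :
  {in A &, injective (fun k : int => (i, k) : 'I_n *l int)}.
Proof. by move=> x y _ _ []. Qed.

Fact component_dom : cofinite_set (pdom component_fun).
Proof.
apply: sub_finite_set (finite_preimage (@pair_inj _) (IOfun_dom a)).
move=> k nk [[j l] ak]; apply: nk; exists l; apply/component_funP.
by have /= e := fst_preserved ak; rewrite {2}e.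
Qed.

Fact component_ran : cofinite_set (pran component_fun).
Proof.
apply: sub_finite_set (finite_preimage (@pair_inj _) (IOfun_ran a)).
move=> k nk [[j l] ak]; apply: nk; exists l; apply/component_funP.
by have /= e := fst_preserved ak; rewrite -{1}e.
Qed.

Definition component : IOZ :=
  IOInf component_inj component_mono component_dom component_ran.

End Component.

Lemma componentK a : of_tuple (component a) = a.
Proof.
apply: IOinf_eq => -[i k] /=; rewrite /tuple_fun /= /component_fun.
by case ak: (a (i, k)) => [[j l]|] //=; have /= -> := fst_preserved ak.
Qed.

Lemma of_tupleM (f g : 'I_n -> IOZ) :
  of_tuple f * of_tuple g = of_tuple (fun i => f i * g i).
Proof.
apply: IOinf_eq => -[i k] /=; rewrite /pcomp /tuple_fun /= /pcomp.
by case: (f i k) => [l|].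
Qed.

Lemma coord_idempotent i (e : IOZ) :
  is_idempotent e -> is_idempotent (Defs.coord i e).
Proof.
move=> ee; rewrite /is_idempotent of_tupleM; congr of_tuple.
by apply/funext => j; case: eqP => _; rewrite ?mulg1.
Qed.

Lemma sigma_coordP i (f g : 'I_n -> IOZ) :
  sigma (f i) (g i) -> (forall j, j != i -> f j = g j) ->
  sigma_coord i (of_tuple f) (of_tuple g).
Proof.
move=> [e [ee fge]] fg; exists e; split=> //; rewrite !of_tupleM.
by congr of_tuple; apply/funext => j; case: eqVneq => [->|/fg ->].
Qed.

Lemma almost_eq_component a b i :
  almost_eq a b -> almost_eq (component a i) (component b i).
Proof.
move=> ab; have inj : {in (fun k : int => (i, k) : 'I_n *l int) @^-1`
    [set x | a x <> b x] &, injective (fun k : int => (i, k) : 'I_n *l int)}.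
  by move=> x y _ _ [].
apply: sub_finite_set (finite_preimage inj ab) => k nk abk; apply: nk.
by rewrite /= /component_fun abk.
Qed.

End Lex.

(** * Composition of the coordinate congruences *)

Lemma big_rel_comp_chain (S : Type) n (F : 'I_n -> S -> S -> Prop)
    (g : nat -> S) : (forall i : 'I_n, F i (g i) (g i.+1)) ->
  (\big[@rel_comp S / eq]_(i < n) F i) (g 0%N) (g n).
Proof.
elim: n F g => [|n IH] F g Fg; first by rewrite big_ord0.
rewrite big_ord_recl; exists (g 1%N); split; first exact: (Fg ord0).
by apply: (IH _ (fun m => g m.+1)) => i; exact: (Fg (lift ord0 i)).
Qed.

Lemma sigma_allP n (a b : IOZlex n) : sigma_all a b <-> sigma a b.
Proof.
rewrite sigmaE; split.
  have cong := almost_eq_congruence ('I_n *l int)%type.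
  rewrite /sigma_all; move: a b.
  (* Relations contained in [almost_eq] include equality and are closed under composition, so it is
     enough to treat each [sigma_coord i]. *)
  apply: (big_ind (fun rho => forall a b, rho a b -> almost_eq a b)).
  - by move=> a _ <-; exact: congr_refl.
  - move=> rho tau rhoS tauS a b [c [/rhoS ac /tauS cb]].
    exact: congr_trans ac cb.
  - move=> i _ a b [e [ee abe]]; apply/sigmaP; exists (Defs.coord i e).
    by split=> //; exact: coord_idempotent.
move=> ab.
(* The first [m] components come from [b], the others from [a]; thus [g i] and [g i.+1] can differ
   only in component [i]. *)
pose g m := of_tuple (fun i : 'I_n =>
  if (i < m)%N then component b i else component a i).
have -> : a = g 0%N by rewrite -[LHS]componentK.
have -> : b = g n.
  rewrite -[LHS]componentK; congr of_tuple; apply/funext => i.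
  by rewrite ltn_ord.
apply: big_rel_comp_chain => i; apply: sigma_coordP.
  by rewrite ltnn leqnn; exact/sigmaP/almost_eq_component.
move=> j ji.
(* For [j != i], the tests [j < i] and [j < i.+1] agree. *)
by rewrite [in RHS]ltnS [in RHS]leq_eqVlt (negPf (ji : val j != val i)).
Qed.

Theorem proposition2p16 (n : nat) (hn : (0 < n)%N) :
  is_least_group_congruence (@sigma_all n) /\
  (forall alpha beta : IOZlex n,
     sigma_all alpha beta <-> sigma alpha beta).
Proof.
split; last exact: sigma_allP.
have -> : @sigma_all n = @sigma (IOZlex n).
  by apply/funext => a; apply/funext => b; apply/propext/sigma_allP.
exact: sigma_least.
Qed.
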